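(* Let $\mathcal C$ be an $(n,k)$ 2D convolutional code with generator matrix $G(z_1,z_2)=\sum_{i,j}G_{ij}z_1^iz_2^j\in\mathbb F[z_1,z_2]^{n\times k}$. If $G_0^{(2)}(z_2)=\sum_jG_{0j}z_2^j$ and $G_0^{(1)}(z_1)=\sum_iG_{i0}z_1^i$ generate an $(n,k,\delta_1)$ and an $(n,k,\delta_2)$ MDP convolutional code, respectively, and in a square of size $(L_1+1)n\times(L_2+1)n$ (with no erasures around this square) there are not more than $$(L_1+L_2+2)(n-k)-(n-1)$$ erasures, where $L_1:=\lfloor\frac{\delta_1}{k}\rfloor+\lfloor\frac{\delta_1}{n-k}\rfloor$ and $L_2:=\lfloor\frac{\delta_2}{k}\rfloor+\lfloor\frac{\delta_2}{n-k}\rfloor$, then Algorithm 2 (described in the context) can correct all erasures inside this square, no matter where they are located.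
   Context: $\mathbb F$ is a finite field. A 2D $(n,k)$ convolutional code is $\mathcal C=\{Gu:u\in\mathbb F[z_1,z_2]^k\}$, a free submodule of $\mathbb F[z_1,z_2]^n$ of rank $k$. For $\{\alpha,\beta\}=\{1,2\}$, write $G=\sum_{l=0}^{\mu_\alpha}G_l^{(\beta)}(z_\beta)z_\alpha^l$ with $\mu_\alpha=\deg_{z_\alpha}G$, $u=\sum_iu_i^{(\beta)}(z_\beta)z_\alpha^i$, and, for the sent codeword, $v=Gu=\sum_{i=0}^{d_\alpha}v_i^{(\beta)}(z_\beta)z_\alpha^i$; then $v_i^{(\beta)}=\sum_{l+m=i}G_l^{(\beta)}u_m^{(\beta)}$. Writing $v=\sum_{i,j}v_{ij}z_1^iz_2^j$ with $v_{ij}\in\mathbb F^n$, one has $v_i^{(2)}(z_2)=\sum_jv_{ij}z_2^j$ and $v_j^{(1)}(z_1)=\sum_iv_{ij}z_1^i$. The coefficient vectors $v_{ij}$ (each consisting of $n$ symbols) are arranged in a two-dimensional array indexed by $(i,j)$, and the square is a part of this array. Over the erasure channel each symbol (component of some $v_{ij}$) arrives correctly or is erased, with known erasure positions; $\hat v$ denotes the received word. Let $e_\beta$ be the largest $e\ge0$ with $k(e+1)<n$ and $[G_e^{(\beta)},\dots,G_0^{(\beta)}](z_\beta)$ of full column rank. 1D codes. An $(n,\kappa)$ (1D) convolutional code is a rank $\kappa$ submodule $\mathcal D\subset\mathbb F[z]^n$, with generator matrix a full column rank $M(z)\in\mathbb F[z]^{n\times\kappa}$ whose columns form a basis; its degree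 $\delta$ is the maximal degree of the full size minors of $M$; it is then called an $(n,\kappa,\delta)$ code. It is noncatastrophic if $M=\bar MX$ with $\bar M\in\mathbb F[z]^{n\times\kappa}$, $X\in\mathbb F[z]^{\kappa\times\kappa}$ forces $X$ to be unimodular. The column distances are $d_j^c(\mathcal D)=\min\{\sum_{t=0}^jwt(w_t):\sum_tw_tz^t\in\mathcal D,\ w_0\ne0\}$ ($wt$ = Hamming weight). $\mathcal D$ is MDP (has maximum distance profile) if $d_j^c(\mathcal D)=(n-\kappa)(j+1)+1$ for $j=0,\dots,L$ with $L=\lfloor\delta/\kappa\rfloor+\lfloor\delta/(n-\kappa)\rfloor$. For $\kappa<n$ let $\tilde{\mathcal D}$ be the smallest noncatastrophic code of rank $\kappa$ containing $\mathcal D$ (so $\tilde{\mathcal D}=\mathcal D$ if $\mathcal D$ is noncatastrophic). A word $\hat w=\sum_{i=0}^s\hat w_iz^i$ of $\mathcal D$ with $\epsilon_i$ erased components in $\hat w_i$ ($\epsilon_i=0$ for $i>s$) ''can be decoded in $\mathcal D$'' if for each $0\le i\le s$ there is $j\ge0$ with $\epsilon_i+\cdots+\epsilon_{i+j}\le d_j^c(\tilde{\mathcal D})-1$; then its erasures are recovered successively for $i=0,\dots,s$ by solving the linear equations given by a parity-check matrix of $\tilde{\mathcal D}$ (Algorithm 1). Algorithm 2. A run in direction $\beta$: starting from $S=0$, as long as possible, take the largest $x\in\{1,\dots,e_\beta+1\}$ with $S+x-1\le d_\alpha$ such that the (current) erasure pattern of $\hat v^{(\beta)}_{S+x-1}$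 can be decoded in the code generated by $[G_{x-1}^{(\beta)},\dots,G_0^{(\beta)}]$; decode $\hat v^{(\beta)}_{S+x-1}-\sum_{l+m=S+x-1,\,m<S}G_l^{(\beta)}u_m^{(\beta)}$ in this code, thereby obtaining $u_S^{(\beta)},\dots,u_{S+x-1}^{(\beta)}$ and hence $v_S^{(\beta)},\dots,v_{S+x-1}^{(\beta)}$; replace $S$ by $S+x$. If $S=d_\alpha+1$ is reached, everything is recovered. (This is Algorithm 2.1, used if $\mu_\alpha>e_\beta$. If $\mu_\alpha=e_\beta$, Algorithm 2.2 is used: it does the same and, when stuck, additionally tries to decode a later block $\hat v_\rho^{(\beta)}$ in the code generated by $[G_{\mu_\alpha}^{(\beta)},\dots,G_0^{(\beta)}]$ and to close the resulting gap backwards by decoding in codes generated by $[G^{(\beta)}_h,\dots,G_w^{(\beta)}]$; if the gap is closed it restarts on the remaining blocks.) Algorithm 2 performs runs alternately in directions $\beta=1$ and $\beta=2$, each time with the symbols recovered so far no longer counted as erased, until everything is recovered or no further symbol is recovered in either direction; in the latter case it additionally tries partial recovery of blocks $\hat v_c^{(\beta)}$ (recovering as many erasures as possible with Algorithm 1 in the code generated by $[G_{\min(c,\mu_\alpha)}^{(\beta)},\dots,G_0^{(\beta)}]$, for $c\le e_\beta$, respectively for all $c\le d_\alpha$ if $\mu_\alpha=e_\beta$) and resumes the runs if any new symbol is recovered, stopping otherwise.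
   Formalization: The formal theorem additionally assumes that the constant coefficient matrix G_00 = G(0,0) has full column rank k (delay-free); without it the claim fails, e.g. for n=4, k=2, G=[g1,(z1+z2)g2], g1=(1,1,1,0), g2=(1,0,0,0), with one erasure in v_00. *)

(* Defs.v *)
From mathcomp Require Import all_boot all_order all_algebra.

Set Implicit Arguments.
Unset Strict Implicit.
Unset Printing Implicit Defensive.

Import GRing.Theory.
Local Open Scope ring_scope.

Inductive exhaust (A : Type) (R : A -> A -> Prop) : A -> A -> Prop :=
| exhaust_stop a : (forall b, ~ R a b) -> exhaust R a a
| exhaust_step a b c : R a b -> exhaust R b c -> exhaust R a c.

(* A polynomial in z_1, z_2 is a {poly {poly F}}: the outer variable is z_1
   and the coefficients are polynomials in z_2.  For a bivariate matrix G,
   mcoef l G is thus G_l^(2)(z_2), and mcoef l (swap_mx G) is G_l^(1)(z_1). *)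
Definition mcoef (R : nzRingType) (m n l : nat) (M : 'M[{poly R}]_(m, n)) :
  'M[R]_(m, n) := map_mx (fun p : {poly R} => p`_l) M.

Definition mdegree (R : nzRingType) (m n : nat) (M : 'M[{poly R}]_(m, n)) : nat :=
  (\max_(i < m) \max_(j < n) (size (M i j)).-1)%N.

Definition swap_mx (R : nzRingType) (m n : nat)
  (M : 'M[{poly {poly R}}]_(m, n)) : 'M[{poly {poly R}}]_(m, n) :=
  map_mx (@swapXY R) M.

Definition full_col_rank (R : idomainType) (m n : nat) (M : 'M[R]_(m, n)) : bool :=
  \rank (map_mx (@FracField.tofrac R) M) == n.

Definition code (R : nzRingType) (n k : nat) (M : 'M[R]_(n, k)) (w : 'cV[R]_n) : Prop :=
  exists u : 'cV[R]_k, w = M *m u.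

Section OneD.
Variable F : finFieldType.

Definition minors_degree (n k : nat) (M : 'M[{poly F}]_(n, k)) : nat :=
  (\max_(f : {ffun 'I_k -> 'I_n}) (size (\det (rowsub f M))).-1)%N.

Definition wt (n : nat) (x : 'cV[F]_n) : nat := #|[set c | x c 0 != 0]|.

Definition trunc_wt (n j : nat) (w : 'cV[{poly F}]_n) : nat :=
  (\sum_(t < j.+1) wt (mcoef t w))%N.

Definition column_distance (n : nat) (D : 'cV[{poly F}]_n -> Prop) (j d : nat) : Prop :=
  (exists w, [/\ D w, mcoef 0 w != 0 & trunc_wt j w = d]) /\
  (forall w, D w -> mcoef 0 w != 0 -> (d <= trunc_wt j w)%N).

Definition mdp_L (n k delta : nat) : nat := (delta %/ k + delta %/ (n - k))%N.

Definition generates_MDP (n k delta : nat) (M : 'M[{poly F}]_(n, k)) : Prop :=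
  [/\ full_col_rank M,
      minors_degree M = delta
    & forall j, (j <= mdp_L n k delta)%N ->
        column_distance (code M) j ((n - k) * j.+1 + 1)].

Definition noncatastrophic (n k : nat) (M : 'M[{poly F}]_(n, k)) : Prop :=
  full_col_rank M /\
  (forall (M' : 'M[{poly F}]_(n, k)) (X : 'M[{poly F}]_k),
     M = M' *m X -> X \in unitmx).

(* Mt generates the smallest noncatastrophic code of rank k containing the
   code generated by M. *)
Definition nc_closure (n k : nat) (M Mt : 'M[{poly F}]_(n, k)) : Prop :=
  [/\ noncatastrophic Mt,
      forall w, code M w -> code Mt w
    & forall M' : 'M[{poly F}]_(n, k), noncatastrophic M' ->
        (forall w, code M w -> code M' w) ->
        forall w, code Mt w -> code M' w].

(* H is left prime: without this its low order coefficients could be rank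
   deficient (e.g. z H' instead of H') and the truncated equations useless. *)
Definition parity_check (n k : nat) (Mt : 'M[{poly F}]_(n, k))
  (H : 'M[{poly F}]_(n - k, n)) : Prop :=
  noncatastrophic H^T /\ (forall w, code Mt w <-> H *m w = 0).

(* y t c is component c of the coefficient of z^t; None is an erasure. *)
Definition pword (n : nat) : Type := nat -> 'I_n -> option F.

Definition known (n : nat) (w : 'cV[{poly F}]_n) : pword n :=
  fun t c => Some (w c 0)`_t.

Definition psub (n : nat) (y : pword n) (p : 'cV[{poly F}]_n) : pword n :=
  fun t c => omap (fun x : F => x - (p c 0)`_t) (y t c).

Definition erasures (n : nat) (y : pword n) (t : nat) : nat :=
  #|[set c | y t c == None]|.

Definition window_ok (n k : nat) (M : 'M[{poly F}]_(n, k)) (y : pword n) (i j : nat) : Prop :=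
  exists Mt d, [/\ nc_closure M Mt, column_distance (code Mt) j d
    & (\sum_(i <= t < (i + j).+1) erasures y t <= d.-1)%N].

(* Indices i after the last erasure impose nothing: take j = 0, as the
   distance there is at least 1. *)
Definition decodable (n k : nat) (M : 'M[{poly F}]_(n, k)) (y : pword n) : Prop :=
  forall i, exists j, window_ok M y i j.

(* x solves the parity-check equations number i, ..., i + j (those for the
   coefficients of z^i, ..., z^(i+j)), given the symbols of y not erased. *)
Definition window_solution (n m : nat) (H : 'M[{poly F}]_(m, n)) (y : pword n)
  (i j : nat) (x : 'cV[{poly F}]_n) : Prop :=
  (forall t c a, (t <= i + j)%N -> y t c = Some a -> (x c 0)`_t = a) /\
  (forall t, (i <= t <= i + j)%N -> mcoef t (H *m x) = 0).

(* One decoding step recovers coefficient i.  The equations used involve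
   only coefficients i - deg H, ..., i + j; those before i must be known.
   Any solution may be returned: that coefficient i of the solution is unique
   is not built in. *)
Definition alg1_step (n k : nat) (M : 'M[{poly F}]_(n, k)) (y y' : pword n) : Prop :=
  exists i j Mt H x,
    [/\ (0 < erasures y i)%N /\ window_ok M y i j,
        nc_closure M Mt /\ parity_check Mt H,
        forall t, (t < i <= t + mdegree H)%N -> erasures y t = 0%N,
        window_solution H y i j x
      & y' = fun t c => if t == i then Some (x c 0)`_i else y t c].

Definition decodes_to (n k : nat) (M : 'M[{poly F}]_(n, k)) (y : pword n)
  (w : 'cV[{poly F}]_n) : Prop :=
  exists2 y', exhaust (alg1_step M) y y' & forall t c, y' t c = known w t c.

End OneD.

Section TwoD.
Variables (F : finFieldType) (n : nat).

(* r i j c is component c of the coefficient of z_1^i z_2^j. *)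
Definition rword : Type := nat -> pword F n.

Definition rswap (r : rword) : rword := fun j i => r i j.

Definition set_block (r : rword) (i : nat) (y : pword F n) : rword :=
  fun i' => if i' == i then y else r i'.

Definition complete (r : rword) : Prop := forall i j c, r i j c <> None.

Definition progress (r r' : rword) : Prop :=
  exists i j c, r i j c = None /\ r' i j c <> None.

(* Outside the (d1+1) x (d2+1) array all coefficients are known to be 0. *)
Definition received (d1 d2 : nat) (v : 'cV[{poly {poly F}}]_n)
  (E : {set 'I_d1.+1 * 'I_d2.+1 * 'I_n}) : rword :=
  fun i j c =>
    if [exists e in E, (val e.1.1, val e.1.2, e.2) == (i, j, c)] then None
    else Some (v c 0)`_i`_j.

(* Side lengths h (along the index i) and w (along the index j) are counted in
   symbols: each coefficient vector contributes n symbols to a line of either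
   direction, so h = (L+1)n means L+1 consecutive values of i. *)
Definition in_square (a b h w i j : nat) : bool :=
  [&& a <= i, (i - a) * n < h, b <= j & (j - b) * n < w]%N.

End TwoD.

(* Everything here is for beta = 2, alpha = 1, with d = d_1; the direction
   beta = 1 is obtained by swapping the variables of G and of the word.
   A list us holds u_0, ..., u_(S-1), so that S = size us. *)
Section Run.
Variables (F : finFieldType) (n k : nat) (G : 'M[{poly {poly F}}]_(n, k)) (d : nat).

(* [G_h, G_(h-1), ..., G_w], for w <= h *)
Definition blk (h w : nat) : 'M[{poly F}]_(n, \sum_(i < (h - w).+1) k) :=
  \mxrow_(i < (h - w).+1) mcoef (h - i) G.

Definition max_e : nat :=
  (\max_(e < n | (k * e.+1 < n) && full_col_rank (blk e 0)) e)%N.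

(* Contribution to v_c of the u_m with index a <= m < a + size us, m <= c,
   where us lists these u_m. *)
Definition contrib (a : nat) (us : seq 'cV[{poly F}]_k) (c : nat) : 'cV[{poly F}]_n :=
  \sum_(i < size us | (a + i <= c)%N) mcoef (c - (a + i)) G *m us`_i.

Definition restore (us : seq 'cV[{poly F}]_k) (r : rword F n) : rword F n :=
  fun i => if (i < size us)%N then known (contrib 0 us i) else r i.

Definition forward_ok (us : seq 'cV[{poly F}]_k) (r : rword F n) (x : nat) : Prop :=
  [/\ (0 < x <= max_e.+1)%N, (size us + x.-1 <= d)%N
    & decodable (blk x.-1 0) (r (size us + x.-1)%N)].

Definition forward_step (us : seq 'cV[{poly F}]_k) (r : rword F n)
  (us' : seq 'cV[{poly F}]_k) (r' : rword F n) : Prop :=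
  exists x new,
    let c := (size us + x.-1)%N in
    [/\ forward_ok us r x /\ (forall x', forward_ok us r x' -> (x' <= x)%N),
        size new = x,
        decodes_to (blk x.-1 0) (psub (r c) (contrib 0 us c)) (contrib (size us) new c),
        us' = us ++ new
      & r' = restore us' r].

Definition stuck (us : seq 'cV[{poly F}]_k) (r : rword F n) : Prop :=
  forall x, ~ forward_ok us r x.

(* State (T, tl, r) while closing a gap: tl lists u_T, ..., u_rho and the gap
   consists of u_S, ..., u_(T-1). *)
Definition gap_state : Type := (nat * seq 'cV[{poly F}]_k * rword F n)%type.

Definition gap_start (us : seq 'cV[{poly F}]_k) (r : rword F n) (g : gap_state) : Prop :=
  exists T tl,
    let rho := (T + mdegree G)%N in
    [/\ (size us < T)%N && (rho <= d)%N,
        decodable (blk (mdegree G) 0) (r rho),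
        size tl = (mdegree G).+1,
        decodes_to (blk (mdegree G) 0) (r rho) (contrib T tl rho)
      & g = (T, tl, set_block r rho (known (contrib T tl rho)))].

(* In block c exactly u_(c-h), ..., u_(c-w) = u_(T-1) are unknown. *)
Definition gap_step (us : seq 'cV[{poly F}]_k) (g g' : gap_state) : Prop :=
  let: (T, tl, r) := g in
  exists c new,
    let h := minn (mdegree G) (c - size us) in
    let w := (c.+1 - T)%N in
    let kn := contrib 0 us c + contrib T tl c in
    let wd := contrib (c - h) new c in
    [/\ (size us < T)%N /\ (T <= c.+1 <= T + mdegree G)%N,
        decodable (blk h w) (r c),
        size new = (h - w).+1,
        decodes_to (blk h w) (psub (r c) kn) wd
      & g' = ((c - h)%N, new ++ tl, set_block r c (known (wd + kn)))].

(* An attempt is available only if mu = e; it closes the gap if it ends with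
   T = size us. *)
Definition gap_attempt (us : seq 'cV[{poly F}]_k) (r : rword F n) (g : gap_state) : Prop :=
  mdegree G = max_e /\
  exists2 g0, gap_start us r g0 & exhaust (gap_step us) g0 g.

Inductive run : seq 'cV[{poly F}]_k -> rword F n -> rword F n -> Prop :=
| run_forward us r us' r' out :
    forward_step us r us' r' -> run us' r' out -> run us r out
| run_gap_closed us r T tl r' out :
    stuck us r -> gap_attempt us r (T, tl, r') -> T = size us ->
    run (us ++ tl) (restore (us ++ tl) r') out -> run us r out
| run_gap_open us r g :
    stuck us r -> gap_attempt us r g ->
    (forall g', gap_attempt us r g' -> g'.1.1 <> size us) ->
    run us r g.2
| run_stuck us r :
    stuck us r -> (forall g, ~ gap_attempt us r g) -> run us r r.

Definition partial_step (r r' : rword F n) : Prop :=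
  exists c y,
    [/\ (c <= d)%N, (c <= max_e)%N \/ mdegree G = max_e,
        alg1_step (blk (minn c (mdegree G)) 0) (r c) y
      & r' = set_block r c y].

End Run.

Section Algorithm2.
Variables (F : finFieldType) (n k : nat) (G : 'M[{poly {poly F}}]_(n, k)) (d1 d2 : nat).

Definition run_dir1 (r r' : rword F n) : Prop :=
  run (swap_mx G) d2 [::] (rswap r) (rswap r').

Definition run_dir2 (r r' : rword F n) : Prop := run G d1 [::] r r'.

Definition partial_recovery : rword F n -> rword F n -> Prop :=
  exhaust (fun r r' =>
    partial_step (swap_mx G) d2 (rswap r) (rswap r') \/ partial_step G d1 r r').

Inductive algorithm2 : rword F n -> rword F n -> Prop :=
| alg2_done r : complete r -> algorithm2 r r
| alg2_runs r r1 r2 out :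
    ~ complete r -> run_dir1 r r1 -> run_dir2 r1 r2 ->
    progress r r2 -> algorithm2 r2 out -> algorithm2 r out
| alg2_partial r r1 r2 r3 out :
    ~ complete r -> run_dir1 r r1 -> run_dir2 r1 r2 -> ~ progress r r2 ->
    partial_recovery r2 r3 -> progress r2 r3 -> algorithm2 r3 out ->
    algorithm2 r out
| alg2_stop r r1 r2 r3 :
    ~ complete r -> run_dir1 r r1 -> run_dir2 r1 r2 -> ~ progress r r2 ->
    partial_recovery r2 r3 -> ~ progress r2 r3 -> algorithm2 r r3.

End Algorithm2.

(* Main.v *)
Require Import Defs.
From mathcomp Require Import all_boot all_order all_fingroup all_algebra.
From mathcomp Require Import zify.
From Stdlib Require Import Classical.

(* A row that Algorithm 2 cannot decode with the code of G_0^(2) contains, by the MDP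
   property, more than (L_1+1)(n-k) erasures, and an undecodable column more than
   (L_2+1)(n-k).  A row and a column share one coefficient, hence at most n symbols, so
   the bound on the number of erasures excludes having both an undecodable row and an
   undecodable column: either all rows or all columns are decodable, and already the
   first pair of runs recovers everything.  Recovered symbols are correct because a
   window with fewer erasures than the column distance has a unique solution, and the
   coefficients of u are unique because the block matrices have full column rank. *)

Set Implicit Arguments.
Unset Strict Implicit.
Unset Printing Implicit Defensive.

Import GRing.Theory.
Local Open Scope ring_scope.

(** * Polynomial matrices *)

(** Euclidean algorithm on the entries: division by a nonzero top entry either clears the rest of
    the column or leaves a nonzero remainder of smaller size, which is swapped to the top. *)
Lemma col_reduction (F : fieldType) p (c : 'cV[{poly F}]_(1 + p)) :
  exists2 U : 'M_(1 + p), U \in unitmx & dsubmx (U *m c) = 0.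
Proof.
suff red N : forall c : 'cV[{poly F}]_(1 + p),
    usubmx c 0 0 != 0 -> (size (usubmx c 0 0)%R <= N)%N ->
    exists2 U : 'M_(1 + p), U \in unitmx & dsubmx (U *m c) = 0.
  have [-> | cn0] := eqVneq c 0.
    by exists 1%:M; rewrite ?unitmx1 // mul1mx linear0.
  have [i ci] : exists i, c i 0 != 0.
    apply/existsP; apply: contraNT cn0; rewrite negb_exists => /forallP c0.
    by apply/eqP/colP=> i; rewrite [RHS]mxE; apply/eqP/negbNE/c0.
  pose c' := tperm_mx (lshift p 0) i *m c.
  have c'0 : usubmx c' 0 0 = c i 0.
    by rewrite /c' -xrowE mxE mxE tpermL.
  have [|U Uu Uc] := red _ c' _ (leqnn _); first by rewrite c'0.
  exists (U *m tperm_mx (lshift p 0) i); last by rewrite -mulmxA.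
  by rewrite unitmx_mul Uu unitmx_perm.
elim: N => [|N IH] {}c c0 szc.
  by move: szc; rewrite leqn0 size_poly_eq0 (negPf c0).
set g := usubmx c 0 0 in c0 szc.
pose q : 'cV[{poly F}]_p := map_mx (fun x => x %/ g) (dsubmx c).
pose r : 'cV[{poly F}]_p := map_mx (fun x => x %% g) (dsubmx c).
pose U1 : 'M[{poly F}]_(1 + p) := block_mx 1%:M 0 (- q) 1%:M.
have U1u : U1 \in unitmx by rewrite unitmxE det_lblock !det1 mulr1 unitr1.
have U1c : U1 *m c = col_mx (usubmx c) r.
  rewrite -[c in LHS]vsubmxK mul_block_col !mul1mx mul0mx addr0; congr col_mx.
  apply/colP=> i; rewrite !mxE big_ord1 !mxE.
  have -> : c (lshift p 0) 0 = g by rewrite /g mxE.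
  by rewrite [X in _ + X](divp_eq _ g) mulNr addKr.
have [r0 | rn0] := eqVneq r 0.
  by exists U1; rewrite // U1c col_mxKd.
have [i ri] : exists i, r i 0 != 0.
  apply/existsP; apply: contraNT rn0; rewrite negb_exists => /forallP r0.
  by apply/eqP/colP=> i; rewrite [RHS]mxE; apply/eqP/negbNE/r0.
pose c' := tperm_mx (lshift p 0) (rshift 1 i) *m (U1 *m c).
have c'0 : usubmx c' 0 0 = r i 0.
  by rewrite /c' -xrowE mxE mxE tpermL U1c col_mxEd.
have [||U Uu Uc] := IH c'; rewrite ?c'0 //.
  by rewrite -ltnS (leq_trans _ szc) // mxE ltn_modp.
exists (U *m tperm_mx (lshift p 0) (rshift 1 i) *m U1); last by rewrite -!mulmxA.
by rewrite !unitmx_mul Uu U1u unitmx_perm.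
Qed.

(** The first column is cleared below its top entry, and the lower right block is treated
    recursively. *)
Lemma col_factorization (F : fieldType) k m (M : 'M[{poly F}]_(k + m, k)) :
  exists2 U : 'M_(k + m), U \in unitmx & dsubmx (U *m M) = 0.
Proof.
elim: k M => [|k IH] M; first by exists 1%:M; rewrite ?unitmx1 // [M]thinmx0 mulmx0 linear0.
have [U1 U1u U1M] := @col_reduction F (k + m) (col 0 M).
pose M1 : 'M_(1 + (k + m), 1 + k) := U1 *m M.
have [U2 U2u U2M] := IH (drsubmx M1).
pose U : 'M[{poly F}]_(1 + (k + m)) := block_mx 1%:M 0 0 U2.
have dl0 : dlsubmx M1 = 0.
  apply/matrixP=> i j; rewrite ord1 mxE mxE.
  have := congr1 (fun A : 'cV__ => A i 0) U1M.
  rewrite !mxE => e; rewrite -[RHS]e; apply: eq_bigr => l _; rewrite mxE; congr (_ * M _ _).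
  by apply: val_inj.
have Uu : U \in unitmx by rewrite unitmxE /U det_lblock det1 mul1r -unitmxE.
exists (U *m U1); first by rewrite unitmx_mul Uu.
have UM : U *m M1 = block_mx (ulsubmx M1) (ursubmx M1) 0 (U2 *m drsubmx M1).
  rewrite -[M1 in LHS]submxK dl0 mulmx_block !mul1mx !mul0mx mulmx0.
  by rewrite !addr0 !add0r.
rewrite -mulmxA; apply/matrixP=> i j; rewrite mxE [RHS]mxE.
(* The shift past [k.+1] rows is split into one row and [k] rows, to match the block form [UM]. *)
have -> : rshift k.+1 i = rshift 1 (rshift k i) by apply: val_inj.
transitivity ((U *m M1) (rshift 1 (rshift k i)) j); first by [].
rewrite UM block_mxEv col_mxEd -(@splitK 1 k j); case: (@split 1 k j) => j' /=.
  by rewrite row_mxEl mxE.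
have := congr1 (fun A : 'M_(m, k) => A i j') U2M.
by rewrite row_mxEr mxE [RHS]mxE.
Qed.

(* [A B] is unimodular, with inverse [N; H]. *)
Lemma saturation (F : fieldType) n k m (M : 'M[{poly F}]_(n, k)) : n = (k + m)%N ->
  exists (A : 'M_(n, k)) (B : 'M_(n, m)) (N : 'M_(k, n)) (H : 'M_(m, n)) (X : 'M_k),
    [/\ M = A *m X, N *m A = 1%:M, H *m A = 0, H *m B = 1%:M
      & A *m N + B *m H = 1%:M].
Proof.
move=> En; subst n; have [U Uu UM] := col_factorization M.
exists (lsubmx (invmx U)), (rsubmx (invmx U)), (usubmx U), (dsubmx U).
exists (usubmx (U *m M)).
have UV := mulmxV Uu; have VU := mulVmx Uu; move: (invmx U) UV VU => V UV VU.
move: UV; rewrite -{1}[U]vsubmxK -{1}[V]hsubmxK mul_col_row scalar_mx_block.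
case/eq_block_mx=> e1 e2 e3 e4.
move: (VU); rewrite -{1}[U]vsubmxK -{1}[V]hsubmxK mul_row_col => e5.
split=> //; last by rewrite -scalar_mx_block.
rewrite -[M in LHS]mul1mx -VU -mulmxA -[U *m M]vsubmxK UM.
by rewrite -{1}[V]hsubmxK mul_row_col mulmx0 addr0 col_mxKu.
Qed.

Lemma full_col_rank_leq (R : idomainType) m n (M : 'M[R]_(m, n)) :
  full_col_rank M -> (n <= m)%N.
Proof. by move=> /eqP <-; exact: rank_leq_row. Qed.

Lemma full_col_rank_inj (R : idomainType) m n p (M : 'M[R]_(m, n)) :
  full_col_rank M -> injective (mulmx M : 'M_(n, p) -> 'M_(m, p)).
Proof.
move=> /row_fullP[B BM] u u' /(congr1 (fun A => B *m map_mx (@FracField.tofrac R) A)).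
rewrite /= !map_mxM !mulmxA !BM !mul1mx => /matrixP e.
apply/matrixP=> i j; have /eqP := e i j.
by rewrite !mxE tofrac_eq => /eqP.
Qed.

Lemma left_inverse_noncatastrophic (F : finFieldType) n k
    (M : 'M[{poly F}]_(n, k)) (N : 'M_(k, n)) :
  N *m M = 1%:M -> noncatastrophic M.
Proof.
move=> NM; split=> [|M' X EM].
  apply/row_fullP; exists (map_mx (@FracField.tofrac _) N).
  by rewrite -map_mxM NM map_mx1.
by move: NM; rewrite EM mulmxA => /mulmx1_unit[].
Qed.

Lemma full_col_rank_det (R : idomainType) n k (A : 'M[R]_(n, k)) (X : 'M_k) :
  full_col_rank (A *m X) -> \det X != 0.
Proof.
rewrite /full_col_rank map_mxM => rM.
have: \rank (map_mx (@FracField.tofrac R) X) == k.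
  by rewrite eqn_leq rank_leq_row -{1}(eqP rM) mxrankM_maxr.
by rewrite -[_ == k]/(row_full _) row_full_unit unitmxE det_map_mx unitfE tofrac_eq0.
Qed.

(** In the saturation [M = A *m X] the factor [X] must be unimodular, so the left inverse [N] of [A]
    yields one of [M]. *)
Lemma noncatastrophic_left_inverse (F : finFieldType) n k (M : 'M[{poly F}]_(n, k)) :
  noncatastrophic M -> exists N, N *m M = 1%:M.
Proof.
move=> [rM ncM]; have En := esym (subnKC (full_col_rank_leq rM)).
have [A [_ [N [_ [X [EM NA _ _ _]]]]]] := saturation M En.
exists (invmx X *m N); rewrite EM -!mulmxA (mulmxA N) NA mul1mx mulVmx //.
exact: ncM EM.
Qed.

(** The factor [A] of the saturation generates the closure. For minimality, [\det X] times a word of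
    [A] lies in the code of [M], hence in that of [M']; a left inverse of [M'] finds its preimage,
    and [\det X] cancels. *)
Lemma nc_closure_exists (F : finFieldType) n k (M : 'M[{poly F}]_(n, k)) :
  full_col_rank M -> exists Mt X, nc_closure M Mt /\ M = Mt *m X.
Proof.
move=> rM; have En := esym (subnKC (full_col_rank_leq rM)).
have [A [_ [N [_ [X [EM NA _ _ _]]]]]] := saturation M En.
exists A, X; split=> //; split; first exact: left_inverse_noncatastrophic NA.
  by move=> w [u ->]; exists (X *m u); rewrite EM mulmxA.
move=> M' /noncatastrophic_left_inverse[N' NM'] MM' _ [u ->].
have detX : \det X != 0 by apply: (full_col_rank_det (A := A)); rewrite -EM.
have [t Et] : code M' (\det X *: (A *m u)).
  apply: MM'; exists (\adj X *m u).
  by rewrite EM -mulmxA (mulmxA X) mul_mx_adj mul_scalar_mx scalemxAr.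
move: (A *m u) Et => w Et; exists (N' *m w).
have: \det X *: w = \det X *: (M' *m (N' *m w)).
  by rewrite !scalemxAr Et (mulmxA N') NM' mul1mx.
move=> /colP e; apply/colP=> i; have := e i; rewrite !mxE.
exact: (mulfI detX).
Qed.

Lemma nc_closure_unique (F : finFieldType) n k (M Mt Mt' : 'M[{poly F}]_(n, k)) w :
  nc_closure M Mt -> nc_closure M Mt' -> code Mt w -> code Mt' w.
Proof. by move=> [_ _ mint] [nc' sub' _]; apply: mint. Qed.

(** The [H] of the saturation is left prime since [B] is a right inverse, and [A *m N + B *m H = 1]
    turns [H *m w = 0] into [w = A *m (N *m w)]. *)
Lemma parity_check_exists (F : finFieldType) n k (Mt : 'M[{poly F}]_(n, k)) :
  noncatastrophic Mt -> exists H, parity_check Mt H.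
Proof.
move=> [rM ncM]; have En := esym (subnKC (full_col_rank_leq rM)).
have [A [B [N [H [X [EM NA HA HB NH]]]]]] := saturation Mt En.
exists H; split=> [|w].
  by apply: (@left_inverse_noncatastrophic _ _ _ _ B^T); rewrite -trmx_mul HB trmx1.
split=> [[u ->]|Hw]; first by rewrite EM !mulmxA HA !mul0mx.
exists (invmx X *m (N *m w)).
rewrite EM -mulmxA mulKVmx; last exact: ncM EM.
by rewrite -[w in LHS]mul1mx -NH mulmxDl -!mulmxA Hw mulmx0 addr0.
Qed.

Lemma mcoefM (R : nzRingType) m n p t (A : 'M[{poly R}]_(m, n)) (B : 'M_(n, p)) :
  mcoef t (A *m B) = \sum_(s < t.+1) mcoef s A *m mcoef (t - s) B.
Proof.
apply/matrixP=> i j; rewrite !mxE coef_sum summxE.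
under eq_bigr do rewrite coefM.
rewrite exchange_big; apply: eq_bigr => s _; rewrite mxE.
by apply: eq_bigr => l _; rewrite !mxE.
Qed.

Lemma mcoef0M (R : nzRingType) m n p (A : 'M[{poly R}]_(m, n)) (B : 'M_(n, p)) :
  mcoef 0 (A *m B) = mcoef 0 A *m mcoef 0 B.
Proof. by rewrite mcoefM big_ord1. Qed.

Lemma mcoefB (R : nzRingType) m n t (A B : 'M[{poly R}]_(m, n)) :
  mcoef t (A - B) = mcoef t A - mcoef t B.
Proof. by apply/matrixP=> i j; rewrite !mxE coefB. Qed.

Lemma mcoef_Xn_scale (F : fieldType) m n j t (A : 'M[{poly F}]_(m, n)) :
  (t < j)%N -> mcoef t ('X^j *: A) = 0.
Proof. by move=> tj; apply/matrixP=> i l; rewrite !mxE coefXnM tj. Qed.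

Lemma mcoef_gt_mdegree (R : nzRingType) m n t (A : 'M[{poly R}]_(m, n)) :
  (mdegree A < t)%N -> mcoef t A = 0.
Proof.
move=> At; apply/matrixP=> i j; rewrite !mxE nth_default //.
apply: leq_trans (leqSpred _) _; apply: leq_ltn_trans At.
by apply: leq_trans (leq_bigmax i); apply: (leq_bigmax j).
Qed.

(** * Algorithm 1 *)

Lemma wt0 (F : finFieldType) n (x : 'cV[F]_n) : (wt x == 0%N) = (x == 0).
Proof.
rewrite cards_eq0; apply/eqP/eqP=> [x0 | ->]; last first.
  by apply/setP=> c; rewrite !inE mxE eqxx.
apply/colP=> c; rewrite [RHS]mxE; apply/eqP/negbNE.
by have /setP/(_ c) := x0; rewrite !inE => ->.
Qed.

(* Shifted by [i], the window of [e] is annihilated by [H] modulo z^(j+1); a right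
   inverse of [H] corrects it to a codeword without changing these coefficients. *)
Lemma window_difference_eq0 (F : finFieldType) n k (Mt : 'M[{poly F}]_(n, k))
    (H : 'M_(n - k, n)) (e : 'cV_n) i j d :
  parity_check Mt H -> column_distance (code Mt) j d ->
  (forall t, (t < i <= t + mdegree H)%N -> mcoef t e = 0) ->
  (forall t, (i <= t <= i + j)%N -> mcoef t (H *m e) = 0) ->
  (\sum_(t < j.+1) wt (mcoef (i + t) e) <= d.-1)%N ->
  mcoef i e = 0.
Proof.
move=> [ncH codeH] [_ minD] past eqs light.
have [N NH] := noncatastrophic_left_inverse ncH.
have HN : H *m N^T = 1%:M by rewrite -[H]trmxK -trmx_mul NH trmx1.
pose e' : 'cV[{poly F}]_n := \col_c \poly_(s < j.+1) (e c 0)`_(i + s).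
have e'E t : (t < j.+1)%N -> mcoef t e' = mcoef (i + t) e.
  by move=> tj; apply/colP=> c; rewrite !mxE coef_poly tj.
have He' t : (t < j.+1)%N -> mcoef t (H *m e') = 0.
  move=> tj; rewrite -(eqs (i + t)%N); last by rewrite leq_addr leq_add2l.
  rewrite !mcoefM -[RHS](big_mkord xpredT
    (fun s => mcoef s H *m mcoef (i + t - s) e)).
  (* The terms with [s > t] involve coefficients of [e] before [i]: they vanish by [past] if
     [s <= mdegree H], and otherwise because coefficient [s] of [H] is zero. *)
  rewrite (big_cat_nat (n := t.+1)) //= ?ltnS ?leq_addl // big_mkord.
  rewrite [X in _ + X](_ : _ = 0) ?addr0.
    by apply: eq_bigr => s _; rewrite e'E ?addnBA //; have := ltn_ord s; lia.
  rewrite big_nat_cond big1 // => s.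
  rewrite andbT => /andP[ts si].
  have [sH | Hs] := leqP s (mdegree H); last by rewrite mcoef_gt_mdegree ?mul0mx.
  rewrite past ?mulmx0 //; lia.
pose q := map_mx (drop_poly j.+1) (H *m e').
have Hq : H *m e' = 'X^(j.+1) *: q.
  apply/colP=> c; rewrite [RHS]mxE [q _ _]mxE mulrC.
  rewrite -[LHS](poly_take_drop j.+1) (_ : take_poly _ _ = 0) ?add0r //.
  apply/polyP=> t; rewrite coef_take_poly coef0; case: ifP => // tj.
  by have /colP/(_ c) := He' t tj; rewrite !mxE.
pose e'' := e' - 'X^(j.+1) *: (N^T *m q).
have codee : code Mt e''.
  by apply/codeH; rewrite mulmxBr -scalemxAr mulmxA HN mul1mx Hq subrr.
have e''E t : (t < j.+1)%N -> mcoef t e'' = mcoef (i + t) e.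
  by move=> tj; rewrite mcoefB mcoef_Xn_scale // subr0 e'E.
have tw : trunc_wt j e'' = (\sum_(t < j.+1) wt (mcoef (i + t) e))%N.
  by apply: eq_bigr => t _; rewrite e''E.
apply/eqP; apply: contraTT light => ei; rewrite -tw -ltnNge.
have := minD e'' codee; rewrite e''E // addn0 => /(_ ei) dle.
(* Positivity is needed for the case [d = 0], where [d.-1] is 0 as well. *)
suff: (0 < trunc_wt j e'')%N by lia.
rewrite tw big_ord_recl addn0 addn_gt0 lt0n wt0 ei //.
Qed.

Definition agrees (F : finFieldType) n (y : pword F n) (w : 'cV[{poly F}]_n) : Prop :=
  forall t c, y t c = None \/ y t c = Some (w c 0)`_t.

Lemma agrees_no_erasure (F : finFieldType) n (y : pword F n) w t :
  agrees y w -> erasures y t = 0%N -> forall c, y t c = Some (w c 0)`_t.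
Proof.
move=> yw /eqP; rewrite cards_eq0 => /eqP/setP y0 c.
by have := y0 c; rewrite !inE; case: (yw t c) => ->.
Qed.

Lemma sum_window n m (f : nat -> nat) :
  (\sum_(n <= t < (n + m).+1) f t = \sum_(s < m.+1) f (n + s))%N.
Proof.
rewrite -addnS -{1}[n]add0n big_addn addKn big_mkord.
by apply: eq_bigr => s _; rewrite addnC.
Qed.

(** Within the window, [x] and [w] differ only at erased symbols, which are too few for a difference
    that is nonzero at coefficient [i]. *)
Lemma alg1_step_agrees (F : finFieldType) n k (M : 'M[{poly F}]_(n, k))
    (y y' : pword F n) w :
  alg1_step M y y' -> code M w -> agrees y w -> agrees y' w.
Proof.
move=> [i [j [Mt [H [x [[_ [Mt' [d [ncl' dist few]]]] [ncl par] past [kn sol] ->]]]]]].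
move=> Mw yw t c; case: eqP => [-> {t} | _]; last exact: yw.
right; congr Some.
(* The closure behind [window_ok] and the one behind [H] may have different generator matrices, but
   they are the same code. *)
have distMt : column_distance (code Mt) j d.
  have [[v [v1 v2 v3]] minD] := dist; split.
    by exists v; split=> //; apply: (nc_closure_unique ncl' ncl).
  by move=> v' cv; apply: minD; apply: (nc_closure_unique ncl ncl').
have Hw : H *m w = 0 by apply/(proj2 par); case: ncl => _ sub _; apply: sub.
have: mcoef i (x - w) = 0.
  apply: window_difference_eq0 par distMt _ _ _.
  - move=> t tH; have y0 := agrees_no_erasure yw (past t tH).
    apply/colP=> c'; rewrite mcoefB !mxE (kn t c' _ _ (y0 c')) ?subrr //.
    by case/andP: tH => ti _; apply: leq_trans (ltnW ti) (leq_addr _ _).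
  - by move=> t tij; rewrite mulmxBr Hw subr0 sol.
  apply: leq_trans few; rewrite sum_window; apply: leq_sum => s _.
  apply/subset_leq_card/subsetP=> c'; rewrite !inE mcoefB !mxE subr_eq0.
  apply: contraR; case: (yw (i + s)%N c') => [-> //|yc _].
  by rewrite (kn _ _ _ _ yc) // leq_add2l -ltnS.
by move=> /colP/(_ c); rewrite mcoefB !mxE => /eqP; rewrite subr_eq0 => /eqP.
Qed.

Lemma decodes_to_sound (F : finFieldType) n k (M : 'M[{poly F}]_(n, k))
    (y : pword F n) w w' :
  code M w -> agrees y w -> decodes_to M y w' -> w' = w.
Proof.
move=> Mw + [y' steps y'E].
elim: steps y'E => {y y'} [y _ | y y1 y' st _ IH] y'E yw; last first.
  exact: IH y'E (alg1_step_agrees st Mw yw).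
apply/colP=> c; apply/polyP=> t.
by have := y'E t c; case: (yw t c) => -> // [].
Qed.

Lemma decodable_le (F : finFieldType) n k (M : 'M[{poly F}]_(n, k)) (y y' : pword F n) :
  (forall t, (erasures y' t <= erasures y t)%N) -> decodable M y -> decodable M y'.
Proof.
move=> le dec i; have [j [Mt [d [ncl dist few]]]] := dec i.
exists j, Mt, d; split=> //; apply: leq_trans few; exact: leq_sum.
Qed.

(** Every step may return [w] itself as its solution. Coefficients are cleared in increasing order,
    and the bound [s] makes the process finite. *)
Lemma decodes_to_exists (F : finFieldType) n k (M : 'M[{poly F}]_(n, k))
    (y : pword F n) w s :
  code M w -> agrees y w -> decodable M y ->
  (forall t, (s <= t)%N -> erasures y t = 0%N) -> decodes_to M y w.
Proof.
(* Coefficients before [q] and from [q + m] on carry no erasures; the induction is on [m]. *)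
move=> Mw; suff rec m q (z : pword F n) : agrees z w -> decodable M z ->
    (forall t, (t < q)%N -> erasures z t = 0%N) ->
    (forall t, (q + m <= t)%N -> erasures z t = 0%N) -> decodes_to M z w.
  by move=> yw dec y0; apply: (rec s 0%N).
elim: m q z => [|m IH] q z zw dec lo hi.
  have z0 t : erasures z t = 0%N.
    by have [/lo // | qt] := ltnP t q; apply: hi; rewrite addn0.
  exists z => [|t c]; last exact: agrees_no_erasure.
  by apply: exhaust_stop => z' [i [j [Mt [H [x [[]]]]]]]; rewrite z0.
have [zq | zq] := posnP (erasures z q).
  apply: (IH q.+1) => // t; last by rewrite addSnnS; apply: hi.
  by rewrite ltnS leq_eqVlt => /predU1P[-> //|]; apply: lo.
have [j wok] := dec q.
have [Mt [d [ncl _ _]]] := wok.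
have [H par] := parity_check_exists (let: And3 nc _ _ := ncl in nc).
pose z1 : pword F n := fun t c => if t == q then Some (w c 0)`_q else z t c.
have z1E t : erasures z1 t = if t == q then 0%N else erasures z t.
  rewrite /erasures /z1; case: ifP => // _; apply/eqP; rewrite cards_eq0.
  by apply/eqP/setP=> c; rewrite !inE.
have [||||z' st z'E] := IH q.+1 z1.
- move=> t c; rewrite /z1; case: eqP => [->|_]; [by right | exact: zw].
- by apply: decodable_le dec => t; rewrite z1E; case: ifP.
- move=> t; rewrite z1E ltnS leq_eqVlt; case: eqP => //= _; exact: lo.
- move=> t qt; rewrite z1E; case: eqP => // _; apply: hi; lia.
exists z' => //; apply: exhaust_step st; exists q, j, Mt, H, w.
split=> //.
- by move=> t /andP[tq _]; apply: lo.
- split=> [t c a _|t _]; first by case: (zw t c) => -> // [].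
  have -> : H *m w = 0 by apply/(proj2 par); case: ncl => _ sub _; apply: sub.
  by apply/matrixP=> i i'; rewrite !mxE coef0.
Qed.

(** * MDP codes *)

Lemma column_distance_ext (F : finFieldType) n (D D' : 'cV[{poly F}]_n -> Prop) j d :
  (forall w, D w <-> D' w) -> column_distance D j d -> column_distance D' j d.
Proof.
move=> DD' [[w [Dw w0 wd]] minD]; split; first by exists w; split=> //; apply/DD'.
by move=> w' /DD'; apply: minD.
Qed.

(* Full rank of the constant coefficients makes [\det X] coprime to z, so every word
   of the closure agrees modulo z^(j+1) with a word of the code. *)
Lemma nc_closure_column_distance (F : finFieldType) n k (M : 'M[{poly F}]_(n, k)) j d :
  full_col_rank M -> \rank (mcoef 0 M) = k -> column_distance (code M) j d ->
  exists Mt, nc_closure M Mt /\ column_distance (code Mt) j d.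
Proof.
move=> rM rM0 [[w [Mw w0 wd]] minD]; have [Mt [X [ncl EM]]] := nc_closure_exists rM.
exists Mt; split=> //; split.
  by exists w; split=> //; case: ncl => _ sub _; apply: sub.
move=> _ [u ->] u0.
have cop : coprimep (\det X) 'X^(j.+1).
  rewrite coprimep_expr // coprimepX rootE horner_coef0.
  have X0u : mcoef 0 X \in unitmx.
    rewrite -row_full_unit /row_full eqn_leq rank_leq_row -{1}rM0 EM mcoef0M.
    exact: mxrankM_maxr.
  have -> : (\det X)`_0 = \det (mcoef 0 X).
    rewrite -horner_coef0 -[LHS]/(horner_eval 0 _) -det_map_mx; congr (\det _).
    by apply/matrixP=> i l; rewrite !mxE /= horner_evalE horner_coef0.
  by rewrite -unitfE -unitmxE.
(* With [a * \det X + b * 'X^(j.+1) = 1], the input [a *: (\adj X *m u)] to [M] reproduces [Mt *m u]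
   up to a multiple of ['X^(j.+1)]. *)
have /Bezout_eq1_coprimepP[[a b] /= ab] := cop.
pose u' := a *: (\adj X *m u).
have E : M *m u' = Mt *m u - 'X^(j.+1) *: (b *: (Mt *m u)).
  rewrite -[Mt *m u in X in X - _]scale1r -ab EM /u' -mulmxA -scalemxAr (mulmxA X).
  rewrite mul_mx_adj mul_scalar_mx scalemxAr -!scalemxAr !scalerA.
  by rewrite scalerDl [b * _]mulrC addrK.
have coefE t : (t < j.+1)%N -> mcoef t (M *m u') = mcoef t (Mt *m u).
  by move=> tj; rewrite E mcoefB mcoef_Xn_scale // subr0.
have -> : trunc_wt j (Mt *m u) = trunc_wt j (M *m u').
  by apply: eq_bigr => t _; rewrite coefE.
by apply: minD; [exists u' | rewrite coefE].
Qed.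

(** The column count of [blk G 0 0] is a one-term sum rather than [k]; the factors [Y] and [Z]
    transfer ranks and codes between the two forms. *)
Lemma blk00E (F : finFieldType) n k (G : 'M[{poly {poly F}}]_(n, k)) :
  exists Y Z, blk G 0 0 = mcoef 0 G *m Y /\ mcoef 0 G = blk G 0 0 *m Z.
Proof.
exists (\mxrow_(i < (0 - 0).+1) 1%:M), (\mxcol_(i < (0 - 0).+1) 1%:M); split.
  by rewrite mul_mxrow; apply: eq_mxrow => i; rewrite mulmx1 sub0n.
by rewrite mul_mxrow_mxcol big_ord1 mulmx1.
Qed.

Lemma full_col_rank_blk00 (F : finFieldType) n k (G : 'M[{poly {poly F}}]_(n, k)) :
  full_col_rank (mcoef 0 G) -> full_col_rank (blk G 0 0).
Proof.
have [Y [Z [EY EZ]]] := blk00E G; rewrite /full_col_rank => /eqP rG.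
rewrite [X in _ == X]big_ord1 -[X in _ == X]rG eqn_leq; apply/andP; split.
  by rewrite EY map_mxM mxrankM_maxl.
by rewrite {1}EZ map_mxM mxrankM_maxl.
Qed.

(** Every window is taken with the same length, [j = mdp_L n k delta], where the column distance is
    [(n - k) * j.+1 + 1]. This distance passes to the closure because the constant coefficient
    matrix has rank [k]. *)
Lemma MDP_row_decodable (F : finFieldType) n k delta
    (G : 'M[{poly {poly F}}]_(n, k)) (y : pword F n) :
  generates_MDP delta (mcoef 0 G) -> \rank (mcoef 0 (mcoef 0 G)) = k ->
  (forall i, (\sum_(s < (mdp_L n k delta).+1) erasures y (i + s)
                <= (n - k) * (mdp_L n k delta).+1)%N) ->
  decodable (blk G 0 0) y.
Proof.
move=> [rG _ /(_ _ (leqnn _)) dist] rG0 few.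
have [Y [Z [EY EZ]]] := blk00E G.
have [Mt [ncl distMt]] : exists Mt, nc_closure (blk G 0 0) Mt /\
    column_distance (code Mt) (mdp_L n k delta) ((n - k) * (mdp_L n k delta).+1 + 1).
  apply: nc_closure_column_distance.
  - exact: full_col_rank_blk00.
  - rewrite [X in _ = X]big_ord1 -[X in _ = X]rG0; apply/eqP.
    rewrite eqn_leq; apply/andP; split; first by rewrite EY mcoef0M mxrankM_maxl.
    by rewrite {1}EZ mcoef0M mxrankM_maxl.
  - apply: column_distance_ext dist => w; split=> [[u ->]|[u ->]].
      by exists (Z *m u); rewrite {1}EZ mulmxA.
    by exists (Y *m u); rewrite EY mulmxA.
move=> i; exists (mdp_L n k delta), Mt, ((n - k) * (mdp_L n k delta).+1 + 1)%N.
by split=> //; rewrite sum_window addn1 /=.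
Qed.

(** * Runs of Algorithm 2 *)

Section Contributions.
Variables (F : finFieldType) (n k : nat) (G : 'M[{poly {poly F}}]_(n, k)).
Implicit Types us new tl : seq 'cV[{poly F}]_k.

Lemma contrib_nil a c : contrib G a [::] c = 0.
Proof. by rewrite /contrib big_ord0. Qed.

Lemma contrib_cat a us new c :
  contrib G a (us ++ new) c = contrib G a us c + contrib G (a + size us) new c.
Proof.
rewrite /contrib size_cat big_split_ord /=; congr (_ + _).
  by apply: eq_bigr => i _; rewrite nth_cat ltn_ord.
apply: eq_big => [i|i _]; rewrite addnA //.
by rewrite nth_cat ltnNge leq_addr addKn.
Qed.

Lemma contrib_nseq0 a m c : contrib G a (nseq m 0) c = 0.
Proof. by rewrite /contrib big1 // => i _; rewrite nth_nseq if_same mulmx0. Qed.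

Lemma contrib_blk us h w c : (w <= h <= c)%N -> size us = (h - w).+1 ->
  contrib G (c - h) us c = blk G h w *m \mxcol_(i < (h - w).+1) us`_i.
Proof.
move=> /andP[wh hc] sz; rewrite mul_mxrow_mxcol /contrib sz.
apply: eq_big => i; first by have := ltn_ord i; lia.
by move=> _; congr (mcoef _ G *m _); have := ltn_ord i; lia.
Qed.

Lemma full_col_rank_blk_max_e : (k < n)%N -> full_col_rank (mcoef 0 G) ->
  full_col_rank (blk G (max_e G) 0).
Proof.
move=> kn rG; have n0 : (0 < n)%N by apply: leq_ltn_trans kn.
pose P := [pred e : 'I_n | (k * e.+1 < n)%N && full_col_rank (blk G e 0)].
have P0 : (0 < #|P|)%N.
  apply/card_gt0P; exists (Ordinal n0).
  by rewrite inE /= muln1 kn full_col_rank_blk00.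
by have [e /andP[_ re]] := eq_bigmax_cond (fun e : 'I_n => nat_of_ord e) P0; rewrite /max_e => ->.
Qed.

(** The columns of [blk G h w] are among those of [blk G (max_e G) 0], so padding with zeros reduces
    the claim to the full column rank of the latter. *)
Lemma contrib_inj us us' h w c : full_col_rank (blk G (max_e G) 0) ->
  (w <= h <= c)%N -> (h <= max_e G)%N ->
  size us = (h - w).+1 -> size us' = (h - w).+1 ->
  contrib G (c - h) us c = contrib G (c - h) us' c -> us = us'.
Proof.
set e := max_e G => re whc he sz sz'; rewrite !(contrib_blk whc) //.
have whe : (w <= h <= e)%N by rewrite he andbT; case/andP: whc.
rewrite -!(contrib_blk whe) //.
(* The [e - h] leading zeros meet the coefficients of index above [h], the [w] trailing ones those
   of index below [w]. *)
pose pad us : seq 'cV[{poly F}]_k := nseq (e - h) 0 ++ us ++ nseq w 0.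
have padE us1 : contrib G (e - h) us1 e = contrib G (e - e) (pad us1) e.
  by rewrite subnn !contrib_cat !contrib_nseq0 add0r addr0 add0n size_nseq.
have szp us1 : size us1 = (h - w).+1 -> size (pad us1) = (e - 0).+1.
  by rewrite !size_cat !size_nseq; lia.
rewrite !padE !(contrib_blk (w := 0)) ?szp ?leqnn // => /(full_col_rank_inj re).
move/eq_mxcolP => eqn; have: pad us = pad us'.
  apply: (@eq_from_nth _ 0) => [|i]; first by rewrite !szp.
  by rewrite szp // => ie; apply: (eqn (Ordinal ie)).
move/eqP; rewrite eqseq_cat // eqxx /= eqseq_cat ?sz ?sz' //.
by case/andP=> /eqP.
Qed.

Variable u : 'cV[{poly {poly F}}]_k.

Definition lists a us : Prop := forall i, (i < size us)%N -> us`_i = mcoef (a + i) u.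

Lemma lists_cat a us new : lists a us -> lists (a + size us) new -> lists a (us ++ new).
Proof.
move=> la lb i; rewrite size_cat nth_cat; case: (ltnP i (size us)) => [ia _|ai ib]; first exact: la.
by rewrite lb ?ltn_subLR // -addnA subnKC.
Qed.

Lemma lists_mkseq a m : lists a (mkseq (fun i => mcoef (a + i) u) m).
Proof. by move=> i; rewrite size_mkseq => im; rewrite nth_mkseq. Qed.

(** Over the common range [m <= c], the contributions of several lists can be added termwise. *)
Lemma contrib_lists a us c : lists a us ->
  contrib G a us c =
  \sum_(m < c.+1) if (a <= m < a + size us)%N then mcoef (c - m) G *m mcoef m u else 0.
Proof.
move=> la; rewrite -big_mkcond /=; pose f m := mcoef (c - m) G *m mcoef m u.
transitivity (\sum_(0 <= i < size us | (i + a <= c)%N) f (i + a)%N).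
  rewrite big_mkord; apply: eq_big => i; rewrite addnC // => _.
  by rewrite la // addnC.
rewrite -{1}(addKn a (size us)).
rewrite -(big_addn 0 (a + size us) a (fun m => m <= c)%N f) add0n.
rewrite -[RHS](big_mkord (fun m => a <= m < a + size us)%N f).
rewrite (big_nat_widenl _ 0) //.
rewrite (big_nat_widen _ _ (maxn (a + size us) c.+1)) ?leq_maxl //.
rewrite [RHS](big_nat_widen _ _ (maxn (a + size us) c.+1)) ?leq_maxr //.
by apply: eq_bigl => m; rewrite ltnS; lia.
Qed.

(** The three lists cover all indices up to [c] except those from [size us] to [a]; there [u] may be
    unknown, but it is multiplied by coefficients of [G] beyond its degree. *)
Lemma mcoef_contrib us a new T tl c :
  lists 0 us -> lists a new -> lists T tl ->
  (size us <= a)%N -> (a + size new = T)%N -> (c < T + size tl)%N ->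
  (forall m, (size us <= m < a)%N -> (m + mdegree G < c)%N) ->
  mcoef c (G *m u) = contrib G 0 us c + contrib G a new c + contrib G T tl c.
Proof.
move=> l1 l2 l3 usa aT cT gap.
rewrite mcoefM (reindex_inj rev_ord_inj) /= !contrib_lists // !add0n.
rewrite -!big_split /=; apply: eq_bigr => m _ /=.
have mc := ltn_ord m; rewrite subSS subKn -1?ltnS //.
have [m1 | m1] := ltnP m (size us).
  by rewrite ifT ?ifN ?addr0 //; lia.
have [m2 | m2] := ltnP m a.
  have := gap m; rewrite m1 m2 => /(_ isT) mG.
  by rewrite mcoef_gt_mdegree ?mul0mx ?if_same ?addr0 //; lia.
rewrite aT /= ltnS ltnNge m1 /= add0r.
have [m3 | m3] := ltnP m T; first by rewrite addr0.
by rewrite add0r ifT //; lia.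
Qed.

Lemma contrib0_lists us c : lists 0 us -> (c < size us)%N ->
  contrib G 0 us c = mcoef c (G *m u).
Proof.
move=> lus cus; rewrite (mcoef_contrib (us := [::]) (a := 0) (new := us)
  (T := size us) (tl := [::])) ?addn0 //.
by rewrite !contrib_nil add0r addr0.
Qed.

End Contributions.

Lemma exhaust_preserves (A : Type) (R : A -> A -> Prop) (P : A -> Prop) a b :
  (forall x y, R x y -> P x -> P y) -> exhaust R a b -> P a -> P b.
Proof. by move=> RP; elim=> {a b} // a b c Rab _ IH Pa; apply: IH; apply: RP Rab Pa. Qed.

Lemma ex_max (P : nat -> Prop) m : (exists x, P x) -> (forall x, P x -> (x <= m)%N) ->
  exists x, P x /\ forall x', P x' -> (x' <= x)%N.
Proof.
elim: m => [|m IH] [x Px] le.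
  by exists x; split=> // x' /le; rewrite leqn0 => /eqP ->.
have [Pm | nPm] := classic (P m.+1); first by exists m.+1.
apply: IH => [|y Py]; first by exists x.
have := le y Py; rewrite leq_eqVlt => /predU1P[ym | //].
by case: nPm; rewrite -ym.
Qed.

Lemma agrees_psub (F : finFieldType) n (y : pword F n) w w' :
  agrees y (w + w') -> agrees (psub y w) w'.
Proof.
move=> yw t c; rewrite /psub; case: (yw t c) => -> /=; [by left | right].
by rewrite mxE coefD addrC addKr.
Qed.

Lemma erasures_psub (F : finFieldType) n (y : pword F n) w t :
  erasures (psub y w) t = erasures y t.
Proof. by apply: eq_card => c; rewrite !inE /psub; case: (y t c). Qed.

(** * Words that are correct apart from remaining erasures *)

Section Soundness.
Variables (F : finFieldType) (n : nat) (v : 'cV[{poly {poly F}}]_n) (d s : nat).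
Implicit Types r : rword F n.

(** Confining the erasures to a finite rectangle makes the decoding of a row finite and all rows
    beyond [d] known. *)
Definition sound r : Prop := forall i t c,
  r i t c = Some (v c 0)`_i`_t \/ [/\ r i t c = None, (i <= d)%N & (t <= s)%N].

Definition extends r r' : Prop := forall i t c,
  r' i t c = Some (v c 0)`_i`_t \/ r' i t c = r i t c.

Lemma extends_refl r : extends r r.
Proof. by right. Qed.

Lemma extends_trans r1 r2 r3 : extends r1 r2 -> extends r2 r3 -> extends r1 r3.
Proof.
move=> e12 e23 i t c; case: (e23 i t c) => ->; first by left.
exact: e12.
Qed.

Lemma sound_extends r r' : sound r -> extends r r' -> sound r'.
Proof. by move=> sr e i t c; case: (e i t c) => ->; [left | apply: sr]. Qed.

Lemma complete_extends r r' : complete r -> extends r r' -> complete r'.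
Proof. by move=> cr e i t c; case: (e i t c) => ->. Qed.

Lemma erasures_extends r r' i t :
  extends r r' -> (erasures (r' i) t <= erasures (r i) t)%N.
Proof.
move=> e; apply/subset_leq_card/subsetP => c; rewrite !inE.
by case: (e i t c) => ->.
Qed.

Lemma agrees_row r i : sound r -> agrees (r i) (mcoef i v).
Proof. by move=> sr t c; rewrite mxE; case: (sr i t c) => [->|[->]]; [right | left]. Qed.

Lemma erasures_row r i t : sound r -> (s < t)%N -> erasures (r i) t = 0%N.
Proof.
move=> sr st; apply/eqP; rewrite cards_eq0; apply/eqP/setP=> c; rewrite !inE.
by case: (sr i t c) => [->|[_ _]] //; rewrite leqNgt st.
Qed.

Lemma extends_set_block r i : extends r (set_block r i (known (mcoef i v))).
Proof.
move=> i' t c; rewrite /set_block; case: eqP => [->|_]; [left | by right].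
by rewrite /known mxE.
Qed.

End Soundness.

(** * Correctness, completeness and existence of runs *)

Section Runs.
Variables (F : finFieldType) (n k : nat) (G : 'M[{poly {poly F}}]_(n, k)).
Variables (u : 'cV[{poly {poly F}}]_k) (d s : nat).
Hypotheses (kn : (k < n)%N) (rG : full_col_rank (mcoef 0 G)).
Local Notation v := (G *m u).
Local Notation e := (max_e G).
Implicit Types (us tl : seq 'cV[{poly F}]_k) (r : rword F n).

Let re : full_col_rank (blk G e 0). Proof. exact: full_col_rank_blk_max_e. Qed.

(** Common core of the forward step, the gap start and the gap step: the decoded word is the true
    one by [decodes_to_sound], and by [contrib_inj] it determines the new coefficients of [u]. *)
Lemma block_decoding r y c h w us new a T tl :
  sound v d s r -> lists u 0 us -> lists u T tl -> (size us <= a)%N ->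
  (w <= h <= c)%N -> (h <= e)%N -> a = (c - h)%N -> T = (c - w).+1 ->
  (c < T + size tl)%N -> (forall m, (size us <= m < a)%N -> (m + mdegree G < c)%N) ->
  agrees y (contrib G a (mkseq (fun i => mcoef (a + i) u) (h - w).+1) c) ->
  size new = (h - w).+1 -> decodes_to (blk G h w) y (contrib G a new c) ->
  lists u a new /\ contrib G 0 us c + contrib G T tl c + contrib G a new c = mcoef c v.
Proof.
move=> sr lus ltl usa whc he Ea ET cT gap yw sz dec; subst a T.
set new0 := mkseq _ _ in yw.
have sz0 : size new0 = (h - w).+1 by rewrite size_mkseq.
have ln0 : lists u (c - h) new0 by apply: lists_mkseq.
have Mw : code (blk G h w) (contrib G (c - h) new0 c).
  by rewrite (contrib_blk G whc sz0); eexists.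
have -> : new = new0.
  exact: contrib_inj re whc he sz sz0 (decodes_to_sound Mw yw dec).
split=> //; rewrite addrAC; apply/esym; apply: mcoef_contrib => //; rewrite sz0; lia.
Qed.

Definition run_inv us r : Prop :=
  [/\ lists u 0 us, sound v d s r, (size us <= d.+1)%N
    & forall i t c, (i < size us)%N -> r i t c <> None].

Lemma run_inv_restore us r r' : lists u 0 us -> sound v d s r -> (size us <= d.+1)%N ->
  extends v r r' -> extends v r (restore G us r') /\ run_inv us (restore G us r').
Proof.
move=> lus sr usd err'; have ext : extends v r' (restore G us r').
  move=> i t c; rewrite /restore; case: ifP => [ius|_]; [left | by right].
  by rewrite (contrib0_lists G lus ius) /known mxE.
have ext' := extends_trans err' ext; split=> //; split=> //.
  exact: sound_extends ext'.
by move=> i t c ius; rewrite /restore ius.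
Qed.

Lemma forward_split us c x : lists u 0 us -> c = (size us + x.-1)%N -> (0 < x)%N ->
  mcoef c v = contrib G 0 us c +
    contrib G (size us) (mkseq (fun i => mcoef (size us + i) u) x) c.
Proof.
move=> lus -> x0; rewrite (mcoef_contrib (us := us) (a := size us)
  (new := mkseq (fun i => mcoef (size us + i) u) x) (T := size us + x) (tl := [::])) //.
- by rewrite contrib_nil addr0.
- exact: lists_mkseq.
- by rewrite size_mkseq.
- by rewrite addn0 /=; lia.
- by move=> m; lia.
Qed.

Lemma forward_step_inv us r us' r' : run_inv us r -> forward_step G d us r us' r' ->
  [/\ run_inv us' r', extends v r r' & (size us < size us')%N].
Proof.
move=> [lus sr usd kr] [x [new [[[/andP[x0 xe] xd dec] _] sz dto -> ->]]].
have [ln _] : lists u (size us) new /\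
    contrib G 0 us (size us + x.-1) + contrib G (size us + x) [::] (size us + x.-1) +
    contrib G (size us) new (size us + x.-1) = mcoef (size us + x.-1) v.
  apply: (block_decoding (h := x.-1) (w := 0) sr) dto => //; try lia.
  apply: agrees_psub; rewrite subn0 prednK //.
  by rewrite -forward_split //; apply: agrees_row.
have lcat : lists u 0 (us ++ new) by apply: lists_cat.
have szcat : size (us ++ new) = (size us + x)%N by rewrite size_cat sz.
have [|ext inv] := run_inv_restore lcat sr _ (extends_refl v r); first by lia.
by split=> //; lia.
Qed.

Lemma forward_step_exists us r x : run_inv us r -> forward_ok G d us r x ->
  exists us' r', forward_step G d us r us' r'.
Proof.
move=> [lus sr usd kr] okx.
have [||{}x [{}okx maxx]] := @ex_max (forward_ok G d us r) e.+1; first by exists x.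
  by move=> y [/andP[]].
have [/andP[x0 xe] xd dec] := okx.
pose new := mkseq (fun i => mcoef (size us + i) u) x.
have sz : size new = x by rewrite size_mkseq.
exists (us ++ new), (restore G (us ++ new) r), x, new; split=> //.
have E := @forward_split us _ x lus erefl x0.
apply: (@decodes_to_exists _ _ _ _ _ _ s.+1).
- have {1}-> : size us = (size us + x.-1 - x.-1)%N by rewrite addnK.
  rewrite (contrib_blk G (h := x.-1) (w := 0)) ?sz ?subn0 ?prednK ?leq_addl //.
  by eexists.
- by apply: agrees_psub; rewrite -E; apply: agrees_row.
- by apply: decodable_le dec => t; rewrite erasures_psub.
- by move=> t; rewrite erasures_psub; apply: erasures_row.
Qed.

(** As the tail has more than [mdegree G] entries, a row treated by [gap_step] involves no
    coefficient of [u] behind the tail. *)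
Definition gap_inv us r (g : gap_state F n k) : Prop :=
  [/\ (size us <= g.1.1)%N, lists u g.1.1 g.1.2, (mdegree G < size g.1.2)%N,
      (g.1.1 + size g.1.2 <= d.+1)%N & extends v r g.2].

Lemma gap_attempt_inv us r g : run_inv us r -> gap_attempt G d us r g -> gap_inv us r g.
Proof.
move=> [lus sr usd kr] [mue [g0 start]] steps.
apply: exhaust_preserves steps _ => [[[T tl] r1] g1|]; last first.
  (* Row [T + mdegree G] does not depend on [u_m] for [m < T], so it is decoded with an empty list
     of known coefficients. *)
  have [T [tl [/andP[ST Td] dec sz dto ->]]] := start; set c := (T + mdegree G)%N.
  have [ltl E] : lists u T tl /\
      contrib G 0 [::] c + contrib G c.+1 [::] c + contrib G T tl c = mcoef c v.
    apply: (block_decoding (h := mdegree G) (w := 0) sr) dto => //; rewrite /c; try lia.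
    have := agrees_row c sr; rewrite (mcoef_contrib (G := G) (u := u) (us := [::]) (a := T)
      (new := mkseq (fun i => mcoef (T + i) u) (mdegree G).+1) (T := c.+1) (tl := [::])) //.
    + by rewrite !contrib_nil add0r addr0 subn0.
    + exact: lists_mkseq.
    + by rewrite size_mkseq addnS.
    + by rewrite addn0.
    + by move=> m /=; rewrite /c; lia.
  rewrite !contrib_nil !add0r in E; split=> /=; rewrite ?sz //; try lia.
  by rewrite E; apply: extends_set_block.
move=> [c [new [[ST /andP[Tc cT]] dec sz dto ->]]] [/= ST' ltl mtl Td ext].
have sr1 := sound_extends sr ext.
(* The unknowns that matter in row [c] run from [c - h] to [T - 1]; those from [size us] to [c - h],
   if any, meet only zero coefficients of [G]. *)
set h := minn _ _ in dec sz dto *; set w := (c.+1 - T)%N in dec sz dto *.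
have split_c : mcoef c v = contrib G 0 us c + contrib G T tl c +
    contrib G (c - h) (mkseq (fun i => mcoef (c - h + i) u) (h - w).+1) c.
  rewrite addrAC; apply: mcoef_contrib => //; rewrite ?size_mkseq /h /w; try lia.
  exact: lists_mkseq.
have [ln E] : lists u (c - h) new /\
    contrib G 0 us c + contrib G T tl c + contrib G (c - h) new c = mcoef c v.
  apply: (block_decoding (h := h) (w := w) sr1) dto => //; rewrite ?/h ?/w; try lia.
  by apply: agrees_psub; rewrite -split_c; apply: agrees_row.
have Tn : (c - h + size new)%N = T by rewrite sz /h /w; lia.
split=> /=.
- by rewrite /h; lia.
- by apply: lists_cat; rewrite ?Tn.
- by rewrite size_cat; lia.
- by rewrite size_cat addnA Tn.
- by rewrite addrC E; apply: extends_trans ext _; apply: extends_set_block.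
Qed.

Lemma gap_closed_inv us r tl r' : run_inv us r ->
  gap_attempt G d us r (size us, tl, r') ->
  [/\ run_inv (us ++ tl) (restore G (us ++ tl) r'),
      extends v r (restore G (us ++ tl) r') & (size us < size (us ++ tl))%N].
Proof.
move=> inv att; have [/= _ ltl mtl Td ext] := gap_attempt_inv inv att.
have [lus sr usd kr] := inv.
have lcat : lists u 0 (us ++ tl) by apply: lists_cat.
have [|ext' inv'] := run_inv_restore lcat sr _ ext; first by rewrite size_cat.
by split=> //; rewrite size_cat; lia.
Qed.

Lemma run_extends us r out : run G d us r out -> run_inv us r -> extends v r out.
Proof.
elim=> {us r out}
  [us r us' r' out st _ IH|us r T tl r' out _ att ET _ IH|us r g _ att _|us r _ _] inv.
- have [inv' ext _] := forward_step_inv inv st.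
  exact: extends_trans ext (IH inv').
- have [|inv' ext _] := @gap_closed_inv us r tl r' inv; first by rewrite -ET.
  exact: extends_trans ext (IH inv').
- by have [] := gap_attempt_inv inv att.
- exact: extends_refl.
Qed.

(** An erasure left in a row [i >= size us] forces [size us <= d]; then [x = 1] is admissible, since
    row [size us] is decodable. *)
Lemma stuck_complete us r : run_inv us r -> stuck G d us r ->
  (forall i, decodable (blk G 0 0) (r i)) -> complete r.
Proof.
move=> [_ sr usd kr] st dec i t c.
have [ius | usi] := ltnP i (size us); first exact: kr.
case: (sr i t c) => [-> // | [_ id _]]; case: (st 1%N); split=> //=; rewrite addn0 //; lia.
Qed.

(** Row decodability survives each step because erasures only disappear, and every run ends from a
    stuck state. *)
Lemma run_complete us r out : run G d us r out -> run_inv us r ->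
  (forall i, decodable (blk G 0 0) (r i)) -> complete out.
Proof.
have dec_ext r1 r2 : extends v r1 r2 -> (forall i, decodable (blk G 0 0) (r1 i)) ->
    forall i, decodable (blk G 0 0) (r2 i).
  by move=> ext dec i; apply: decodable_le (dec i) => t; apply: erasures_extends.
elim=> {us r out}
  [us r us' r' out st _ IH|us r T tl r' out _ att ET _ IH|us r g st att _|us r st _] inv dec.
- have [inv' ext _] := forward_step_inv inv st.
  exact: IH inv' (dec_ext _ _ ext dec).
- have [|inv' ext _] := @gap_closed_inv us r tl r' inv; first by rewrite -ET.
  exact: IH inv' (dec_ext _ _ ext dec).
- have [_ _ _ _ ext] := gap_attempt_inv inv att.
  exact: complete_extends (stuck_complete inv st dec) ext.
- exact: stuck_complete inv st dec.
Qed.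

(** Each forward step and each closed gap lengthens [us], whose size is at most [d.+1]. *)
Lemma run_exists us r : run_inv us r -> exists out, run G d us r out.
Proof.
have [m] := ubnP (d.+1 - size us)%N; elim: m us r => // m IH us r lem inv.
have rec us' r' : run_inv us' r' -> (size us < size us')%N -> exists out, run G d us' r' out.
  by move=> inv' lt; apply: (IH) (inv'); have [_ _ ? _] := inv; have [_ _ ? _] := inv'; lia.
have [[x okx] | nok] := classic (exists x, forward_ok G d us r x).
  have [us' [r' st]] := forward_step_exists inv okx.
  have [inv' _ lt] := forward_step_inv inv st.
  have [out ro] := rec _ _ inv' lt.
  by exists out; apply: run_forward st ro.
have st : stuck G d us r by move=> x okx; apply: nok; exists x.
have [[[[T tl] r'] [att ET]] | nclosed] :=
    classic (exists g, gap_attempt G d us r g /\ g.1.1 = size us).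
  rewrite /= in ET; rewrite ET in att; have [inv' _ lt] := gap_closed_inv inv att.
  have [out ro] := rec _ _ inv' lt.
  by exists out; apply: run_gap_closed st att erefl ro.
have [[g att] | natt] := classic (exists g, gap_attempt G d us r g).
  exists g.2; apply: run_gap_open st att _ => g' att' ET.
  by apply: nclosed; exists g'.
by exists r; apply: run_stuck st _ => g att; apply: natt; exists g.
Qed.

End Runs.

(** * Counting erasures *)

(** Fibres over distinct values are disjoint: after exchanging the sums, each [x] is counted at most
    once. *)
Lemma sum_card_fibers (T : finType) (A : {set T}) (f : T -> nat) j m :
  (\sum_(t < m) #|[set x in A | f x == j + t]| <= #|A|)%N.
Proof.
under eq_bigr => t _ do rewrite -sum1dep_card big_mkcondr.
rewrite exchange_big -sum1_card; apply: leq_sum => x _ /=.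
rewrite -big_mkcond sum1_card; apply/card_le1_eqP => t1 t2.
by rewrite !unfold_in => /eqP -> /eqP /addnI /esym; apply: val_inj.
Qed.

Section Counting.
Variables (F : finFieldType) (n : nat) (v : 'cV[{poly {poly F}}]_n) (d1 d2 : nat).
Variable E : {set 'I_d1.+1 * 'I_d2.+1 * 'I_n}.

Lemma receivedP i j c :
  received v E i j c = Some (v c 0)`_i`_j \/
  exists x, [/\ received v E i j c = None, x \in E, val x.1.1 = i, val x.1.2 = j & x.2 = c].
Proof.
rewrite /received; case: ifP => [/existsP[x /andP[xE /eqP[<- <- <-]]] | _]; last by left.
by right; exists x.
Qed.

Lemma erasures_received i j :
  (erasures (received v E i) j <= #|[set x in E | (x.1.1 == i :> nat) && (x.1.2 == j :> nat)]|)%N.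
Proof.
apply: leq_trans (leq_imset_card snd _).
apply/subset_leq_card/subsetP=> c; rewrite inE.
have [-> // | [x [_ xE <- <- <-]] _] := receivedP i j c.
by apply: imset_f; rewrite inE xE !eqxx.
Qed.

Lemma row_erasures i j m :
  (\sum_(t < m) erasures (received v E i) (j + t) <= #|[set x in E | x.1.1 == i :> nat]|)%N.
Proof.
apply: leq_trans (sum_card_fibers _ (fun x => val x.1.2) j m).
apply: leq_sum => t _; apply: leq_trans (erasures_received _ _) _.
by apply/subset_leq_card/subsetP=> x; rewrite !inE andbA.
Qed.

Lemma column_erasures i j m :
  (\sum_(t < m) erasures (rswap (received v E) j) (i + t)
     <= #|[set x in E | x.1.2 == j :> nat]|)%N.
Proof.
apply: leq_trans (sum_card_fibers _ (fun x => val x.1.1) i m).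
apply: leq_sum => t _; apply: leq_trans (erasures_received _ _) _.
by apply/subset_leq_card/subsetP=> x; rewrite !inE => /and3P[-> -> ->].
Qed.

(* A row and a column meet in a single coefficient, that is, in at most [n] symbols. *)
Lemma row_column_card i j :
  (#|[set x in E | x.1.1 == i :> nat]| + #|[set x in E | x.1.2 == j :> nat]| <= #|E| + n)%N.
Proof.
rewrite -cardsUI leq_add //.
  by apply/subset_leq_card/subsetP=> x; rewrite !inE => /orP[] /andP[].
(* In the intersection both array indices are fixed, so the component alone identifies a symbol. *)
rewrite -(card_in_imset (f := snd)) => [|x y].
  by apply: leq_trans (max_card _) _; rewrite card_ord.
rewrite !inE => /andP[/andP[_ /eqP x1] /andP[_ /eqP x2]].
move=> /andP[/andP[_ /eqP y1] /andP[_ /eqP y2]].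
case: x x1 x2 y1 y2 => [[xi xj] xc] /= x1 x2; case: y => [[yi yj] yc] /= y1 y2 ->.
by congr (_, _, _); apply: val_inj; rewrite /= ?x1 ?x2.
Qed.

Lemma sound_received : sound v d1 d2 (received v E).
Proof.
move=> i j c; case: (receivedP i j c) => [|[x [rN _ xi xj _]]]; [by left | right].
by split=> //; rewrite -ltnS -?xi -?xj ltn_ord.
Qed.

End Counting.

(** * Exchanging the variables, and the theorem *)

Lemma progress_complete (F : finFieldType) n (r r' : rword F n) :
  ~ complete r -> complete r' -> progress r r'.
Proof.
move=> nc cr'; apply: NNPP => np; apply: nc => i j c rN; apply: np.
by exists i, j, c; split=> //; apply: cr'.
Qed.

Lemma mcoef00_swap (R : nzRingType) m n (G : 'M[{poly {poly R}}]_(m, n)) :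
  mcoef 0 (mcoef 0 (swap_mx G)) = mcoef 0 (mcoef 0 G).
Proof. by apply/matrixP=> i j; rewrite !mxE coef_swapXY. Qed.

Lemma extends_rswap (F : finFieldType) n (v : 'cV[{poly {poly F}}]_n) (r r' : rword F n) :
  extends (swap_mx v) (rswap r) (rswap r') <-> extends v r r'.
Proof.
split=> e i j c; have := e j i c; by rewrite mxE coef_swapXY.
Qed.

Lemma sound_rswap (F : finFieldType) n (v : 'cV[{poly {poly F}}]_n) d s (r : rword F n) :
  sound v d s r -> sound (swap_mx v) s d (rswap r).
Proof.
by move=> sr j i c; rewrite mxE coef_swapXY; case: (sr i j c) => [|[]]; [left | right].
Qed.

Theorem theorem5p1 (F : finFieldType) (n k : nat)
  (G : 'M[{poly {poly F}}]_(n, k)) (delta1 delta2 : nat)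
  (hk : (0 < k < n)%N)
  (hG : full_col_rank G)
  (hG2 : generates_MDP delta1 (mcoef 0 G))
  (hG1 : generates_MDP delta2 (mcoef 0 (swap_mx G)))
  (hG00 : \rank (mcoef 0 (mcoef 0 G)) = k)
  (L1 L2 : nat)
  (hL1 : L1 = (delta1 %/ k + delta1 %/ (n - k))%N)
  (hL2 : L2 = (delta2 %/ k + delta2 %/ (n - k))%N)
  (v : 'cV[{poly {poly F}}]_n) (hv : code G v)
  (d1 d2 : nat) (hd1 : (mdegree v <= d1)%N) (hd2 : (mdegree (swap_mx v) <= d2)%N)
  (E : {set 'I_d1.+1 * 'I_d2.+1 * 'I_n})
  (a b h w : nat)
  (hsize : (h = (L1 + 1) * n /\ w = (L2 + 1) * n)%N \/
           (h = (L2 + 1) * n /\ w = (L1 + 1) * n)%N)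
  (hsquare : forall e, e \in E -> in_square n a b h w e.1.1 e.1.2)
  (hcount : (#|E| + (n - 1) <= (L1 + L2 + 2) * (n - k))%N) :
  (exists out, algorithm2 G d1 d2 (received v E) out) /\
  (forall out, algorithm2 G d1 d2 (received v E) out ->
     forall i j c, out i j c = Some (v c 0)`_i`_j).
Proof.
move: hv hk => [u Ev] /andP[k0 kn].
pose r0 := received v E.
have Evs : swap_mx v = swap_mx G *m swap_mx u by rewrite Ev [LHS]map_mxM.
have rG2 : full_col_rank (mcoef 0 G) by case: hG2.
have rG1 : full_col_rank (mcoef 0 (swap_mx G)) by case: hG1.
have lines : (forall i, decodable (blk G 0 0) (r0 i)) \/
    (forall j, decodable (blk (swap_mx G) 0 0) (rswap r0 j)).
  apply: NNPP => /not_or_and[/not_all_ex_not[i rowi] /not_all_ex_not[j colj]].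
  have row_many : ((n - k) * L1.+1 < #|[set x in E | x.1.1 == i :> nat]|)%N.
    rewrite ltnNge; apply: contra_notN rowi => few.
    apply: (MDP_row_decodable hG2 hG00) => j'.
    by rewrite (esym hL1 : mdp_L _ _ _ = L1); apply: leq_trans few; apply: row_erasures.
  have col_many : ((n - k) * L2.+1 < #|[set x in E | x.1.2 == j :> nat]|)%N.
    rewrite ltnNge; apply: contra_notN colj => few.
    apply: (MDP_row_decodable hG1); first by rewrite mcoef00_swap.
    move=> i'; rewrite (esym hL2 : mdp_L _ _ _ = L2).
    by apply: leq_trans few; apply: column_erasures.
  (* With [B] the product in [hcount], the two lines contain at least [B + 2] erasures counted with
     overlap, so [B + 2 <= #|E| + n], whereas [hcount] gives [#|E| + n <= B + 1]. *)
  have := row_column_card E i j; move: hcount row_many col_many.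
  have -> : ((L1 + L2 + 2) * (n - k) = (n - k) * L1.+1 + (n - k) * L2.+1)%N.
    by rewrite -mulnDr mulnC; congr muln; lia.
  lia.
have inv0 d s r : sound (G *m u) d s r -> run_inv G u d s [::] r.
  by move=> sr; split.
have inv0s d s r : sound (swap_mx G *m swap_mx u) d s r ->
    run_inv (swap_mx G) (swap_mx u) d s [::] r.
  by move=> sr; split.
have inv1 r : extends v r0 r -> run_inv (swap_mx G) (swap_mx u) d2 d1 [::] (rswap r).
  move=> ext; apply: inv0s; rewrite -Evs; apply: sound_rswap.
  exact: sound_extends (sound_received v E) ext.
have inv2 r : extends v r0 r -> run_inv G u d1 d2 [::] r.
  by move=> ext; apply: inv0; rewrite -Ev; apply: sound_extends (sound_received v E) ext.
(* If all columns are decodable, the run in direction 1 already completes the word; otherwise all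
   rows are, and they remain so for the run in direction 2. *)
have runs r r1 r2 : extends v r0 r -> run_dir1 G d2 r r1 -> run_dir2 G d1 r1 r2 ->
    extends v r r2 /\ complete r2.
  move=> ext run1 run2.
  have ext1 : extends v r r1.
    by apply/extends_rswap; rewrite Evs; apply: run_extends run1 (inv1 _ ext).
  have ext01 := extends_trans ext ext1.
  have ext2 : extends v r1 r2.
    by rewrite Ev; apply: run_extends run2 (inv2 _ ext01).
  split; first exact: extends_trans ext1 ext2.
  case: lines => dec.
    apply: (run_complete kn rG2 run2 (inv2 _ ext01)) => i.
    by apply: decodable_le (dec i) => t; apply: (erasures_extends _ _ ext01).
  apply: complete_extends ext2 => i j c.
  apply: (run_complete kn rG1 run1 (inv1 _ ext)) => j'.
  apply: decodable_le (dec j') => t.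
  by apply: (erasures_extends (v := swap_mx v)); apply/extends_rswap.
split.
  have [cr0 | ncr0] := classic (complete r0); first by exists r0; apply: alg2_done.
  (* This [r1] has its indices swapped; the word passed on to direction 2 is [rswap r1]. *)
  have [r1 run1] := run_exists kn rG1 (inv1 _ (extends_refl v r0)).
  have ext1 : extends v r0 (rswap r1).
    apply/extends_rswap; rewrite Evs.
    exact: run_extends run1 (inv1 _ (extends_refl v r0)).
  have [r2 run2] := run_exists kn rG2 (inv2 _ ext1).
  have [_ cr2] := runs r0 (rswap r1) r2 (extends_refl v r0) run1 run2.
  exists r2; apply: (@alg2_runs _ _ _ G d1 d2 r0 (rswap r1) r2 _ ncr0 run1 run2).
    exact: progress_complete.
  exact: alg2_done.
(* The start is generalised from [r0] to any [r] extending it, so that the induction passes through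
   repeated runs. *)
move=> out; rewrite -/r0; move: (extends_refl v r0); move: {2 3}r0 => r ext alg.
elim: alg ext => {r out}.
- move=> r cr ext i j c.
  have [//|[rN _ _]] := sound_extends (sound_received v E) ext i j c.
  by case: (cr i j c).
- move=> r r1 r2 out _ run1 run2 _ _ IH ext; apply: IH.
  have [ext2 _] := runs _ _ _ ext run1 run2; exact: extends_trans ext ext2.
(* Partial recovery and stopping require runs without progress, but one pair of runs completes an
   incomplete word. *)
- move=> r r1 r2 r3 out ncr run1 run2 nprog _ _ _ _ ext; case: nprog.
  by have [_] := runs _ _ _ ext run1 run2; apply: progress_complete.
- move=> r r1 r2 r3 ncr run1 run2 nprog _ _ ext; case: nprog.
  by have [_] := runs _ _ _ ext run1 run2; apply: progress_complete.
Qed.
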